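(* If $R$ is a UNC ring and $G$ is a locally finite $2$-group, then the group ring $RG$ is a UNC ring.
   Context: Rings are associative with identity, not necessarily commutative. An element $a$ of a ring $S$ is nil-clean if $a=e+b$ with $e^2=e\in S$ and $b\in S$ nilpotent ($e$ and $b$ need not commute). A ring $S$ is a UNC ring if every unit of $S$ is nil-clean. $RG$ is the group ring of $G$ over $R$. A group is locally finite if each of its finitely generated subgroups is finite; a group is a $2$-group if the order of each of its elements is a (finite) power of $2$. *)

(* Defs.v *)
From HB Require Import structures.
From mathcomp Require Import all_boot all_algebra finmap.
From mathcomp.classical Require Import classical_sets cardinality.
From mathcomp.multinomials Require Import monalg.

Set Implicit Arguments.
Unset Strict Implicit.
Unset Printing Implicit Defensive.

Import GRing.Theory.
Local Open Scope ring_scope.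

(* Rings are [pzRingType]s, so the zero ring is allowed. [GRing.unit] is only
   available on [unitRingType]s, whence the explicit notion of unit. *)
Section Rings.
Context {S : pzRingType}.

Definition is_unit (u : S) : Prop := exists v : S, u * v = 1 /\ v * u = 1.

Definition is_idempotent (e : S) : Prop := e ^+ 2 = e.

Definition is_nilpotent (b : S) : Prop := exists n : nat, b ^+ n = 0.

Definition nil_clean (a : S) : Prop :=
  exists e b : S, [/\ is_idempotent e, is_nilpotent b & a = e + b].

End Rings.

Definition UNC_ring (S : pzRingType) : Prop :=
  forall u : S, is_unit u -> nil_clean u.

Section Groups.
Local Open Scope group_scope.
Local Open Scope classical_set_scope.
Context {G : groupType}.

Definition is_subgroup (H : set G) : Prop :=
  [/\ H 1, (forall x y, H x -> H y -> H (x * y)) & (forall x, H x -> H x^-1)].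

Definition finitely_generated (H : set G) : Prop :=
  exists A : set G, finite_set A /\ H = smallest is_subgroup A.

Definition has_order (x : G) (n : nat) : Prop :=
  [/\ (0 < n)%N, x ^+ n = 1 & forall m, (0 < m)%N -> x ^+ m = 1 -> (n <= m)%N].

End Groups.

Definition locally_finite (G : groupType) : Prop :=
  forall H : set G, is_subgroup H -> finitely_generated H -> finite_set H.

Definition is_2group (G : groupType) : Prop :=
  forall x : G, exists k : nat, has_order x (2 ^ k)%N.

(* [{malg R[G]}] is the additive group of finitely supported functions G -> R.
   Its ring structure in monalg requires a [monomType], i.e. a monoid whose
   only unit is 1, so the convolution product is redefined here on an alias. *)
Definition groupRing (R : pzRingType) (G : groupType) : Type := {malg R[G]}.

HB.instance Definition _ (R : pzRingType) (G : groupType) :=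
  GRing.Zmodule.on (groupRing R G).

Section GroupRing.
Context {R : pzRingType} {G : groupType}.
Implicit Types (a b c : groupRing R G) (x y : G) (r s : R).

Definition gr_one : groupRing R G := << 1 *g (1%g : G) >>.

Definition gr_mul a b : groupRing R G :=
  \sum_(x <- msupp a) \sum_(y <- msupp b) << a@_x * b@_y *g (x * y)%g >>.

Let gr_mulw (d1 d2 : {fset G}) a b : (msupp a `<=` d1)%fset -> (msupp b `<=` d2)%fset ->
  gr_mul a b = \sum_(x <- d1) \sum_(y <- d2) << a@_x * b@_y *g (x * y)%g >>.
Proof.
move=> le1 le2; rewrite /gr_mul (big_fset_incl _ le1) /=.
  apply/eq_bigr=> x _; apply/big_fset_incl => // y _ /mcoeff_outdom ->.
  by rewrite mulr0 monalgU0.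
move=> x _ /mcoeff_outdom ax0.
by rewrite big1 // => y _; rewrite ax0 mul0r monalgU0.
Qed.

Lemma gr_mulUU r s x y :
  gr_mul << r *g x >> << s *g y >> = << r * s *g (x * y)%g >>.
Proof. by rewrite (gr_mulw msuppU_le msuppU_le) !big_seq_fset1 !mcoeffUU. Qed.

Let gr_mulDl : left_distributive gr_mul +%R.
Proof.
move=> a b c.
rewrite (gr_mulw (msuppD_le a b) (fsubset_refl (msupp c))).
rewrite (gr_mulw (fsubsetUl _ (msupp b)) (fsubset_refl (msupp c))).
rewrite (gr_mulw (fsubsetUr (msupp a) _) (fsubset_refl (msupp c))).
rewrite -big_split /=; apply/eq_bigr=> x _.
rewrite -big_split /=; apply/eq_bigr=> y _.
by rewrite mcoeffD mulrDl monalgUD.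
Qed.

Let gr_mulDr : right_distributive gr_mul +%R.
Proof.
move=> c a b.
rewrite (gr_mulw (fsubset_refl (msupp c)) (msuppD_le a b)).
rewrite (gr_mulw (fsubset_refl (msupp c)) (fsubsetUl _ (msupp b))).
rewrite (gr_mulw (fsubset_refl (msupp c)) (fsubsetUr (msupp a) _)).
rewrite -big_split /=; apply/eq_bigr=> x _.
rewrite -big_split /=; apply/eq_bigr=> y _.
by rewrite mcoeffD mulrDr monalgUD.
Qed.

Let gr_mul0l b : gr_mul 0 b = 0.
Proof. by rewrite /gr_mul msupp0 big_seq_fset0. Qed.

Let gr_mul0r a : gr_mul a 0 = 0.
Proof. by rewrite /gr_mul big1 // => x _; rewrite msupp0 big_seq_fset0. Qed.

Let gr_ind (P : groupRing R G -> Prop) :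
  P 0 -> (forall a b, P a -> P b -> P (a + b)) ->
  (forall r x, P << r *g x >>) -> forall a, P a.
Proof. by move=> P0 PD PU a; rewrite [a]monalgE; apply: big_ind. Qed.

Let gr_mulA : associative gr_mul.
Proof.
move=> a b c; elim/gr_ind: a => [|a a' IH IH'|r x]; first by rewrite !gr_mul0l.
  by rewrite !gr_mulDl IH IH'.
elim/gr_ind: b => [|b b' IH IH'|s y]; first by rewrite !(gr_mul0l, gr_mul0r).
  by rewrite !(gr_mulDl, gr_mulDr) IH IH'.
elim/gr_ind: c => [|c c' IH IH'|t z]; first by rewrite !gr_mul0r.
  by rewrite !gr_mulDr IH IH'.
by rewrite !gr_mulUU mulrA mulgA.
Qed.

Let gr_mul1l : left_id gr_one gr_mul.
Proof.
elim/gr_ind => [|a b IH IH'|r x]; first exact: gr_mul0r.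
  by rewrite gr_mulDr IH IH'.
by rewrite gr_mulUU mul1r mul1g.
Qed.

Let gr_mul1r : right_id gr_one gr_mul.
Proof.
elim/gr_ind => [|a b IH IH'|r x]; first exact: gr_mul0l.
  by rewrite gr_mulDl IH IH'.
by rewrite gr_mulUU mulr1 mulg1.
Qed.

HB.instance Definition _ := GRing.Zmodule_isPzRing.Build (groupRing R G)
  gr_mulA gr_mul1l gr_mul1r gr_mulDl gr_mulDr.

End GroupRing.

(* Main.v *)
(* If [gr_aug u = e + b] is a nil-clean decomposition in R, then [u = e + (u - e)]
   is one in RG, provided every element of the augmentation ideal is nilpotent:
   some power of [u - e] has augmentation a power of [b] that vanishes.
   Since 2 is nilpotent in a UNC ring (decompose the unit -1), and an element of
   the augmentation ideal is a combination of the [x - 1] for x in a finite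
   2-group, it suffices that long products of such factors are divisible by 2.
   This goes by induction along subgroups K of index 2 in M: modulo 2, a product
   of two factors [x - 1] with x in M lies in the ideal of RM generated by the
   [k - 1] with k in K, because for x, y outside K
     (x - 1)(y - 1) = (xy - 1) + (xy^-1 - 1) y + 2 (1 - x). *)

From mathcomp.classical Require Import classical_sets cardinality.
Require Import Defs.
From HB Require Import structures.
From mathcomp Require Import all_boot all_algebra finmap.
From mathcomp Require Import fingroup cyclic pgroup gseries maximal.
From mathcomp.multinomials Require Import monalg.

Set Implicit Arguments.
Unset Strict Implicit.
Unset Printing Implicit Defensive.

Import GRing.Theory.
Local Open Scope ring_scope.

(** * Additive spans, and cosets of a subgroup of index two *)

Section AdditiveSpan.
Context {S : pzRingType}.
Implicit Types (P Q : S -> Prop) (c x y : S).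

(** Opposites are not built in: for [filt] below they come from -u = u + 2(-u), since even elements
    are generators. *)
Inductive add_span P : S -> Prop :=
| add_span0 : add_span P 0
| add_span_gen x : P x -> add_span P x
| add_spanD x y : add_span P x -> add_span P y -> add_span P (x + y).

Lemma add_span_mulr P Q c :
  (forall x, P x -> add_span Q (x * c)) ->
  forall x, add_span P x -> add_span Q (x * c).
Proof.
move=> PQ x; elim=> [|{}x /PQ //|{}x y _ IHx _ IHy].
  by rewrite mul0r; apply: add_span0.
by rewrite mulrDl; apply: add_spanD.
Qed.

Lemma add_span_even P :
  (forall x, P x -> exists s, x = s *+ 2) ->
  forall x, add_span P x -> exists s, x = s *+ 2.
Proof.
move=> Peven x; elim=> [|{}x /Peven //|_ _ _ [s ->] _ [t ->]].
  by exists 0; rewrite mul0rn.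
by exists (s + t); rewrite mulrnDl.
Qed.

End AdditiveSpan.

(** Otherwise K, Kx and Ky^-1 would be three distinct right cosets of K in M. *)
Lemma mulg_notin_index2 (gT : finGroupType) (K M : {group gT}) (x y : gT) :
  K \subset M -> (#|M : K| = 2)%g -> x \in M -> y \in M ->
  x \notin K -> y \notin K -> (x * y)%g \in K.
Proof.
move=> sKM iKM Mx My nKx nKy; apply: contraT => nKxy.
have neq a b : (a * b^-1)%g \notin K -> (K :* a == K :* b)%g = false.
  by move=> nKab; apply/eqP => /rcoset_eqP; rewrite mem_rcoset (negPf nKab).
have : (#|[set (K :* 1)%g; (K :* x)%g; (K :* y^-1)%g]| <= #|rcosets K M|)%N.
  apply/subset_leq_card/subsetP => z.
  by rewrite !inE => /orP[/orP[]|] /eqP ->; rewrite -rcosetE imset_f ?groupV.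
rewrite -/(indexg M K) iKM -setUA cardsU1 cards2 !inE.
by rewrite !neq ?mul1g ?invgK ?groupV.
Qed.

(** * Products of factors [f x - 1] over a finite 2-group, modulo 2 *)

Section AugmentationWords.
Context {S : pzRingType} {gT : finGroupType} (f : gT -> S).
Context (f1 : f 1%g = 1) (fM : forall x y, f (x * y)%g = f x * f y).
Implicit Types (K M : {group gT}) (w : seq gT) (x y : gT) (s u : S).

Definition aug_word w : S := \prod_(x <- w) (f x - 1).

Lemma aug_word_rcons w x : aug_word (rcons w x) = aug_word w * (f x - 1).
Proof. by rewrite /aug_word -cats1 big_cat big_seq1. Qed.

Section IndexTwo.
Context (K M : {group gT}) (nKM : (K <| M)%g).
Context (KM2 : forall x y, x \in M -> y \in M -> x \notin K -> y \notin K ->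
  (x * y)%g \in K).

(* [filt i] is 2 S plus the i-th power of the ideal generated by the [f k - 1],
   k in K, of the subring generated by [f @: M]. *)
Definition filt_gen i u : Prop :=
  (exists s, u = s *+ 2) \/
  (exists w x, [/\ size w = i, all (mem K) w, x \in M & u = aug_word w * f x]).

Definition filt i := add_span (filt_gen i).

Lemma filt_even i s : filt i (s *+ 2).
Proof. by apply: add_span_gen; left; exists s. Qed.

Lemma filtN i u : filt i u -> filt i (- u).
Proof.
move=> Fu; have -> : - u = u + (- u) *+ 2.
  by rewrite mulr2n addrA subrr add0r.
exact: add_spanD Fu (filt_even _ _).
Qed.

Lemma filt_mulf i u x : x \in M -> filt i u -> filt i (u * f x).
Proof.
move=> Mx; apply: add_span_mulr => _ [[s ->]|[w [y [sz Kw My ->]]]].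
  by rewrite mulrnAl; apply: filt_even.
apply: add_span_gen; right; exists w, (y * x)%g; split=> //.
  exact: groupM.
by rewrite fM mulrA.
Qed.

Lemma filt_mulf1 i u x : x \in M -> filt i u -> filt i (u * (f x - 1)).
Proof.
move=> Mx Fu; rewrite mulrBr mulr1.
by apply: add_spanD (filtN Fu); apply: filt_mulf.
Qed.

(* Normality of [K] moves the new factor to the left of [f x]. *)
Lemma filt_mulK i u k : k \in K -> filt i u -> filt i.+1 (u * (f k - 1)).
Proof.
move=> Kk; apply: add_span_mulr => _ [[s ->]|[w [x [sz Kw Mx ->]]]].
  by rewrite mulrnAl; apply: filt_even.
have Kkx : (x * k * x^-1)%g \in K.
  rewrite -[X in (X * k)%g]invgK -mulgA -/(conjg _ _) memJ_norm //.
  by rewrite groupV (subsetP (normal_norm nKM)).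
apply: add_span_gen; right; exists (rcons w (x * k * x^-1)%g), x; split=> //.
- by rewrite size_rcons sz.
- by rewrite all_rcons /= Kkx.
rewrite aug_word_rcons -!mulrA; congr (_ * _).
by rewrite mulrBr mulrBl mulr1 mul1r -!fM mulgKV.
Qed.

Lemma filt_mul_pair i u x y :
  x \in M -> y \in M -> filt i u -> filt i.+1 (u * (f x - 1) * (f y - 1)).
Proof.
move=> Mx My Fu.
have [Ky|nKy] := boolP (y \in K); first by apply/filt_mulK/filt_mulf1.
have [Kx|nKx] := boolP (x \in K); first by apply/filt_mulf1/filt_mulK.
have Kxy : (x * y)%g \in K by apply: KM2.
have KxVy : (x * y^-1)%g \in K by apply: KM2; rewrite ?groupV.
have -> : u * (f x - 1) * (f y - 1) =
    u * (f (x * y)%g - 1) + u * (f (x * y^-1)%g - 1) * f y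
    + (u * (1 - f x)) *+ 2.
  rewrite -!mulrA -mulrnAr -!mulrDr; congr (_ * _).
  rewrite [in RHS]mulrBl -fM mulgKV mul1r fM mulr2n.
  rewrite mulrBl mulrBr mulr1 mul1r opprB.
  rewrite [in RHS]addrA -(addrA (_ - 1) (f x - f y)) (addrC (f x - f y)) !subrKA.
  by rewrite addrACA [RHS]addrACA [- f x + _]addrC.
apply: add_spanD (filt_even _ _); apply: add_spanD.
  exact: filt_mulK.
by apply: filt_mulf => //; apply: filt_mulK.
Qed.

(** The letters are consumed in pairs from the right, each pair raising the level of [filt] by
    one. *)
Lemma filt_aug_word n w : all (mem M) w -> size w = n.*2 -> filt n (aug_word w).
Proof.
elim: n w => [|n IHn] w.
  move=> _ /size0nil ->; apply: add_span_gen; right; exists [::], 1%g.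
  by split; rewrite ?f1 ?mulr1.
case/lastP: w => // w y; case/lastP: w => // w x.
rewrite !all_rcons !size_rcons => /and3P[/= My Mx Mw] [sz].
by rewrite !aug_word_rcons; apply: filt_mul_pair => //; apply: IHn.
Qed.

End IndexTwo.

(** Induction on the order of M: a maximal subgroup K of a nontrivial 2-group is normal of index 2,
    and if length n suffices for K, then length 2n suffices for M. *)
Lemma aug_word_even M : (2.-group M)%g ->
  exists n, forall w, all (mem M) w -> size w = n ->
  exists s, aug_word w = s *+ 2.
Proof.
have [m] := ubnP #|M|; elim: m M => // m IHm M leMm pM.
have [M1|[K maxK _]] := maximal_exists (sub1G M).
  (* In the trivial group a single factor already vanishes. *)
  exists 1%N => [[|x []]] //= /[!andbT]; rewrite -M1 => /set1P -> _.
  by exists 0; rewrite /aug_word big_seq1 f1 subrr mul0rn.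
have ltKM := maxgroupp maxK.
have nKM := p_maximal_normal pM maxK.
have iKM := p_maximal_index pM maxK.
have [] := IHm K.
- by apply: leq_trans (proper_card ltKM) _.
- exact: pgroupS (proper_sub ltKM) pM.
move=> n evenK; exists n.*2 => w Mw sz.
have KM2 x y := @mulg_notin_index2 gT K M x y (proper_sub ltKM) iKM.
have := filt_aug_word nKM KM2 Mw sz; apply: add_span_even.
(* A generator of [filt n] that is not visibly even starts with a word of length n in K. *)
move=> u [//|[w' [x [sz' Kw' Mx ->]]]].
by have [s ->] := evenK _ Kw' sz'; exists (s * f x); rewrite mulrnAl.
Qed.

(** The [a i] commute with the values of [f], though perhaps not with each other. In the expanded
    power they are collected on the left, in order, which leaves a word of length n on the right. *)
Lemma sum_aug_nilpotent_mod2 (I : Type) (r : seq I) (a : I -> S) (h : I -> gT) :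
  (2.-group [set: gT])%g -> (forall i x, GRing.comm (a i) (f x)) ->
  exists n s, (\sum_(i <- r) a i * (f (h i) - 1)) ^+ n = s *+ 2.
Proof.
move=> pG fa; have [n evenG] := @aug_word_even [set: gT]%G pG.
set c := \sum_(i <- r) _; exists n.
pose P j u := exists b w, [/\ size w = j, (forall x, GRing.comm b (f x)) &
  u = b * aug_word w].
suff: add_span (P n) (c ^+ n).
  apply: add_span_even => _ [b [w [sz _ ->]]].
  have [||s ->] := evenG w => //; first by apply/allP => x _; rewrite /= inE.
  by exists (b * s); rewrite mulrnAr.
elim: (n) => [|j IHj].
  apply: add_span_gen; exists 1, [::]; split=> // [x|].
    exact/commr_sym/commr1.
  by rewrite /aug_word big_nil mulr1.
rewrite exprSr; apply: add_span_mulr IHj => _ [b [w [sz fb ->]]].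
rewrite /c; elim/big_ind: _ => [|x y Px Py|i _].
- by rewrite mulr0; apply: add_span0.
- by rewrite mulrDr; apply: add_spanD.
apply: add_span_gen; exists (b * a i), (rcons w (h i)); split.
- by rewrite size_rcons sz.
- by move=> x; apply/commr_sym/commrM; apply/commr_sym.
rewrite aug_word_rcons -!mulrA; congr (_ * _); rewrite !mulrA; congr (_ * _).
apply/esym/commr_prod => x _; apply: commrB => //; exact: commr1.
Qed.

End AugmentationWords.

(** * Passage to a finite 2-group, and nilpotency of 2 *)

Lemma finite_subgroup_finGroupType (G : groupType) (H : set G) :
  is_subgroup H -> finite_set H ->
  exists (gT : finGroupType) (phi : gT -> G),
    [/\ injective phi, phi 1%g = 1%g, {morph phi : x y / (x * y)%g} &
        forall x, H x -> exists h, phi h = x].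
Proof.
move=> + /finite_fsetP[X HX]; rewrite {}HX => -[X1 XM XV].
pose one : X := [` X1]%fset.
pose mul (x y : X) : X := [` XM _ _ (valP x) (valP y)]%fset.
pose inv (x : X) : X := [` XV _ (valP x)]%fset.
have mulA : associative mul by move=> x y z; apply/val_inj/mulgA.
have mul1 : left_id one mul by move=> x; apply/val_inj/mul1g.
have mulV : left_inverse one inv mul by move=> x; apply/val_inj/mulVg.
pose gT : finGroupType :=
  HB.pack (Finite.sort X) (Finite_isGroup.Build X mulA mul1 mulV).
exists gT, (val : X -> G); split=> //; first exact: val_inj.
by move=> x Xx; exists [` Xx]%fset.
Qed.

(** By Cauchy, a prime p dividing the order of [gT] is the order of some x. Injectivity of [phi]
    pulls a relation x^(2^k) = 1 back from G, so p divides 2^k. *)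
Lemma is_2group_pgroup (G : groupType) (gT : finGroupType) (phi : gT -> G) :
  injective phi -> phi 1%g = 1%g -> {morph phi : x y / (x * y)%g} ->
  is_2group G ->
  (2.-group [set: gT])%g.
Proof.
move=> phi_inj phi1 phiM G2.
have phiX x n : phi (x ^+ n)%g = (phi x ^+ n)%g.
  by elim: n => // n IHn; rewrite !expgS phiM IHn.
apply/pgroupP => p p_pr /(Cauchy p_pr)[x _ ordx].
have [k [_ xk1 _]] := G2 (phi x).
have : (p %| 2 ^ k)%N.
  by rewrite -ordx order_dvdn -(inj_eq phi_inj) phiX xk1 phi1.
by rewrite Euclid_dvdX // dvdn_prime2 // => /andP[].
Qed.

(* If [-1 = e + b], then [e + 1 = - b] is nilpotent, while [e + 1] acts as the
   identity on [1 - e] and as [2] on [e]. *)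
Lemma UNC_two_nilpotent (R : pzRingType) :
  UNC_ring R -> exists k, (2 ^ k)%:R = 0 :> R.
Proof.
move=> /(_ (-1)) []; first by exists (-1); rewrite mulrNN mulr1.
move=> e [b [ee [n bn0] def]].
have {}ee : e * e = e by rewrite -expr2.
have e1n : (e + 1) ^+ n = 0.
  have -> : e + 1 = - b by rewrite -[1]opprK def opprD addrA subrr sub0r.
  by rewrite exprNn bn0 mulr0.
have e1 : e = 1.
  apply/esym/eqP; rewrite -subr_eq0; apply/eqP.
  rewrite -[RHS](mulr0 (1 - e)) -e1n; elim: (n) => [|j IHj].
    by rewrite mulr1.
  rewrite exprS mulrA [X in X * _ ^+ j](_ : _ = 1 - e) //.
  by rewrite mulrDr mulr1 mulrBl mul1r ee subrr add0r.
by exists n; rewrite natrX -e1n e1.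
Qed.

(** * The augmentation map of RG and nilpotency of its kernel *)

Section GroupRingAugmentation.
Context {R : pzRingType} {G : groupType}.
Implicit Types (a b c : groupRing R G) (x y : G) (r s : R).

Lemma groupRing_mulUU r s x y :
  (<< r *g x >> : groupRing R G) * << s *g y >> = << r * s *g (x * y)%g >>.
Proof. exact: gr_mulUU. Qed.

Lemma groupRing_ind (P : groupRing R G -> Prop) :
  P 0 -> (forall a b, P a -> P b -> P (a + b)) ->
  (forall r x, P << r *g x >>) -> forall a, P a.
Proof. by move=> P0 PD PU a; rewrite [a]monalgE; apply: big_ind. Qed.

Definition gr_aug a : R := \sum_(x <- msupp a) a@_x.

Lemma gr_augEw (d : {fset G}) a : (msupp a `<=` d)%fset ->
  gr_aug a = \sum_(x <- d) a@_x.
Proof.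
by move=> le; rewrite /gr_aug (big_fset_incl _ le) // => x _ /mcoeff_outdom.
Qed.

Lemma gr_augU r x : gr_aug << r *g x >> = r.
Proof. by rewrite (gr_augEw msuppU_le) big_seq_fset1 mcoeffUU. Qed.

Lemma gr_augD : {morph gr_aug : a b / a + b}.
Proof.
move=> a b; rewrite (gr_augEw (msuppD_le a b)).
rewrite (gr_augEw (fsubsetUl (msupp a) (msupp b))).
rewrite (gr_augEw (fsubsetUr (msupp a) (msupp b))) -big_split.
by apply: eq_bigr => x _; rewrite mcoeffD.
Qed.

Lemma gr_aug0 : gr_aug 0 = 0.
Proof. by rewrite /gr_aug msupp0 big_seq_fset0. Qed.

Lemma gr_augM : {morph gr_aug : a b / a * b}.
Proof.
move=> a b; elim/groupRing_ind: a => [|a a' IH IH'|r x].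
- by rewrite mul0r gr_aug0 mul0r.
- by rewrite mulrDl !gr_augD IH IH' mulrDl.
elim/groupRing_ind: b => [|b b' IH IH'|s y].
- by rewrite mulr0 gr_aug0 mulr0.
- by rewrite mulrDr !gr_augD IH IH' mulrDr.
by rewrite groupRing_mulUU !gr_augU.
Qed.

Lemma gr_aug1 : gr_aug 1 = 1.
Proof. exact: gr_augU. Qed.

Lemma gr_augX a n : gr_aug (a ^+ n) = gr_aug a ^+ n.
Proof. by elim: n => [|n IHn]; rewrite ?gr_aug1 // !exprS gr_augM IHn. Qed.

(** Subtracting [gr_aug c] times 1, which is 0, from the expansion of c over its support turns each
    x into x - 1. *)
Lemma gr_aug0_sum c : gr_aug c = 0 ->
  c = \sum_(x <- msupp c) (<< c@_x *g 1%g >> : groupRing R G)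
        * ((<< 1 *g x >> : groupRing R G) - 1).
Proof.
move=> c0; under eq_bigr do
  rewrite mulrBr mulr1 groupRing_mulUU mulr1 mul1g.
rewrite sumrB -[LHS]subr0 {1}[c]monalgE; congr (_ - _).
rewrite -(raddf_sum (@mkmalgU G R 1%g)) /=.
by rewrite -[X in mkmalgU _ X]/(gr_aug c) c0 monalgU0.
Qed.

Lemma gr_aug0_nilpotent c k :
  locally_finite G -> is_2group G -> (2 ^ k)%:R = 0 :> R ->
  gr_aug c = 0 -> is_nilpotent c.
Proof.
move=> Gfin G2 R2 c0.
(* The support of c is finite, so the subgroup it generates is finite. *)
pose A := [set` msupp c]%classic; pose H := smallest is_subgroup A.
have Hgrp : is_subgroup H.
  split=> [B [[] //]|x y Hx Hy B BP|x Hx B BP]; have [[B1 BM BV] _] := BP.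
    by apply: BM; [apply: Hx|apply: Hy].
  by apply: BV; apply: Hx.
have Hfin : finite_set H.
  by apply: Gfin => //; exists A; split=> //; apply: finite_fset.
have [gT [phi [phi_inj phi1 phiM phiH]]] :=
  finite_subgroup_finGroupType Hgrp Hfin.
have gT2 := is_2group_pgroup phi_inj phi1 phiM G2.
(* A section of [phi] over H; the default 1 is never reached on the support of c. *)
pose psi x := odflt 1%g [pick h | phi h == x].
have psiK x : x \in msupp c -> phi (psi x) = x.
  move=> cx; rewrite /psi; case: pickP => [h /eqP //|/= no].
  have [h hx] : exists h, phi h = x by apply: phiH; apply: sub_gen_smallest; exact: cx.
  by have := no h; rewrite hx eqxx.
pose f h : groupRing R G := << 1 *g phi h >>.
have f1 : f 1%g = 1 by rewrite /f phi1.
have fM (x y : gT) : f (x * y)%g = f x * f y by rewrite /f phiM groupRing_mulUU mulr1.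
have [|n [s]] := @sum_aug_nilpotent_mod2 _ _ f f1 fM _ (msupp c)
  (fun x => << c@_x *g 1%g >>) psi gT2.
  by move=> x h; rewrite /GRing.comm !groupRing_mulUU mulr1 mul1r mulg1 mul1g.
have -> : \sum_(x <- msupp c) (<< c@_x *g 1%g >> : groupRing R G)
    * (f (psi x) - 1) = c.
  rewrite [RHS]gr_aug0_sum //; apply: eq_big_seq => x cx.
  by rewrite /f psiK.
(* Here c^n = 2s, so c^(nk) = 2^k s^k = 0. *)
move=> cn; exists (n * k)%N.
rewrite exprM cn exprMn_n -[s ^+ k]mulr1 -mulrnAr.
by rewrite -monalgUMn R2 monalgU0 mulr0.
Qed.

End GroupRingAugmentation.

Theorem proposition2p19 (R : pzRingType) (G : groupType) :
  UNC_ring R -> locally_finite G -> is_2group G -> UNC_ring (groupRing R G).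
Proof.
move=> RUNC Gfin G2 u [v [uv vu]].
have [k R2] := UNC_two_nilpotent RUNC.
have [|e [b [ee [n bn0] def]]] := RUNC (gr_aug u).
  by exists (gr_aug v); rewrite -!gr_augM uv vu gr_aug1.
pose E : groupRing R G := << e *g 1%g >>.
exists E, (u - E); split; last by rewrite addrC subrK.
  by rewrite /is_idempotent expr2 groupRing_mulUU mulg1 -expr2 ee.
have augb : gr_aug (u - E) = b.
  apply: (addrI e); rewrite -def -[e in LHS](@gr_augU R G e 1%g) -gr_augD.
  by rewrite addrC subrK.
have [|m um0] := @gr_aug0_nilpotent R G ((u - E) ^+ n) k Gfin G2 R2.
  by rewrite gr_augX augb.
by exists (n * m)%N; rewrite exprM.
Qed.
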